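(* Every $4$-blocked point set has at most $12$ points, and there is a $4$-blocked point set with exactly $12$ points.
   Context: All point sets are finite subsets of the Euclidean plane. A point $x$ blocks two points $v$ and $w$ if $x$ is in the interior of the line segment $\overline{vw}$. Two points $v,w$ are visible with respect to a point set $P$ if no point in $P$ blocks $v$ and $w$. A point set $P$ is $k$-blocked if each point in $P$ is assigned one of $k$ colours such that each pair of distinct points $v,w\in P$ are visible with respect to $P$ if and only if $v$ and $w$ are coloured differently. *)

(* Defs.v *)
(* MathComp; real numbers from MathComp-Analysis. *)
From mathcomp Require Export all_boot all_order all_algebra.
From mathcomp Require Export finmap.
From mathcomp Require Export reals.

Set Implicit Arguments.
Unset Strict Implicit.
Unset Printing Implicit Defensive.

Import GRing.Theory Num.Theory.

Local Open Scope ring_scope.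

(* For v = w this degenerates to x = v; it is only used for v <> w. *)
Definition blocks (R : realType) (x v w : 'rV[R]_2) : Prop :=
  exists t : R, 0 < t < 1 /\ x = (1 - t) *: v + t *: w.

Definition visible (R : realType) (P : {fset 'rV[R]_2}) (v w : 'rV[R]_2) : Prop :=
  ~ exists x : 'rV[R]_2, x \in P /\ blocks x v w.

(* The colouring is a function on the points of P only, and need not use all
   k colours. *)
Definition blocked (R : realType) (k : nat) (P : {fset 'rV[R]_2}) : Prop :=
  exists c : P -> 'I_k,
    forall v w : P, v <> w -> (visible P (val v) (val w) <-> c v <> c w).

(* Main.v *)
Require Import Defs.
From mathcomp Require Import boolp ring lra zify.

(** A point of [P] between two points of [P] has a colour different from theirs, so no four points
    of [P] are collinear. Removing extreme points keeps a set blocked, so if there are more than 12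
    points we may assume that there are exactly 13, and four of them have the same colour. Up to
    relabelling these four are in convex position or one is inside the triangle of the others.

    Both positions are refuted by exhaustive search over what is known of the colours and
    orientations of a growing list of points of [P]. The search takes a pair of known points of the
    same colour without a known blocker: the blocker is either a known point of another colour, or
    a new point, whose orientations with respect to two known points follow whenever the ends of
    the blocked segment are on the same side. When every pair has its blocker, an arbitrary further
    point is added. There being only 13 points, the search ends. *)

Set Implicit Arguments.
Unset Strict Implicit.
Unset Printing Implicit Defensive.

Import Order.TTheory GRing.Theory Num.Theory.

(** * The search *)

(* What is known of the orientation of an ordered triple of known points: [Lin] is for three
   distinct collinear points, [Deg] for a triple with a repeated point. *)
Inductive orient_info := Unk | Pos | Neg | Lin | Deg.

Definition opp_info (a : orient_info) : orient_info :=
  match a with Pos => Neg | Neg => Pos | _ => a end.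

(* The orientation of (x,m,y), with [m] between [u] and [v], from those of (x,u,y) and (x,v,y). *)
Definition mid_info (a c : orient_info) : orient_info :=
  match a, c with
  | Pos, (Pos | Lin | Deg) | (Lin | Deg), Pos => Pos
  | Neg, (Neg | Lin | Deg) | (Lin | Deg), Neg => Neg
  | Deg, Deg => Deg
  | _, _ => Unk
  end.

Definition table := seq (seq (seq orient_info)).

Definition entries (t : table) (i j : nat) : seq orient_info := nth [::] (nth [::] t i) j.

Definition entry (t : table) (i j k : nat) : orient_info := nth Unk (entries t i j) k.

Fixpoint map_pair (A B C : Type) (f : A -> B -> C) (s : seq A) (r : seq B) : seq C :=
  match s, r with
  | a :: s', b :: r' => f a b :: map_pair f s' r'
  | _, _ => [::]
  end.

Fixpoint update (A : Type) (f : A -> A) (s : seq A) (i : nat) : seq A :=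
  match s, i with
  | [::], _ => [::]
  | a :: s', 0 => f a :: s'
  | a :: s', i'.+1 => a :: update f s' i'
  end.

Definition set_entry (t : table) (i j k : nat) (a : orient_info) : table :=
  update (fun rows => update (fun r => update (fun=> a) r k) rows j) t i.

Definition record (t : table) (i j k : nat) (a : orient_info) : table :=
  let b := opp_info a in
  set_entry (set_entry (set_entry (set_entry (set_entry (set_entry t
    i j k a) j k i a) k i j a) j i k b) k j i b) i k j b.

(* Points are numbered in order of appearance, and so are their colours; (u,m,v) in [blockings]
   means that [m] blocks [u] and [v]. *)
Record state := State {
  tab : table;
  colours : seq nat;
  ncolours : nat;
  blockings : seq (nat * nat * nat) }.

Definition is_lin (a : orient_info) : bool := if a is Lin then true else false.

(** A collinear triple of points of [P] has only its ends in the same colour. So for [u] and [v] of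
    one colour, a third point on record as collinear with them is their blocker. *)
Definition unblocked (t : table) (u v : nat) : bool :=
  ~~ has (fun r => is_lin (nth Unk r v)) (nth [::] t u).

(* If [m] is between [u] and [v], then for any other [w] the triples (u,m,w), (u,v,w) have the
   same nonzero orientation and (v,m,w) has the opposite one. *)
Fixpoint compatible (rum rvm ruv : seq orient_info) : bool :=
  match rum, rvm, ruv with
  | a :: rum', b :: rvm', c :: ruv' =>
    match a, b, c with
    | Lin, _, _ | _, Lin, _ => false
    | Pos, Pos, _ | Neg, Neg, _ | Pos, _, Neg | Neg, _, Pos | _, Pos, Pos | _, Neg, Neg => false
    | _, _, _ => compatible rum' rvm' ruv'
    end
  | _, _, _ => true
  end.

Definition candidate (s : state) (u v m : nat) : bool :=
  if eqn (nth 0 (colours s) m) (nth 0 (colours s) u) then false else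
  let ruv := entries (tab s) u v in
  match nth Unk ruv m with
  | Pos | Neg => false
  | _ => compatible (entries (tab s) u m) (entries (tab s) v m) ruv
  end.

(* The rows [R] list, for known [i] and [k], the orientation of (i,n,k) with [n] the new point. *)
Definition extend (t : table) (R : seq (seq orient_info)) : table :=
  rcons (map_pair (fun rows Rx =>
           rcons (map_pair (fun r a => rcons r (opp_info a)) rows Rx) (rcons Rx Deg)) t R)
        (rcons (map (fun Rx => rcons (map opp_info Rx) Deg) R) (nseq (size t).+1 Deg)).

(** At the ends themselves [mid_info] only combines two [Deg] entries, although [u], [v] and the new
    point are distinct and collinear; hence the two entries overwritten by [Lin]. *)
Definition blocker_rows (t : table) (u v : nat) : seq (seq orient_info) :=
  let R := map (fun rows => map_pair mid_info (nth [::] rows u) (nth [::] rows v)) t in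
  update (fun r => update (fun=> Lin) r u) (update (fun r => update (fun=> Lin) r v) R u) v.

Definition free_rows (n : nat) : seq (seq orient_info) :=
  map (update (fun=> Deg) (nseq n Unk)) (iota 0 n).

(** [None] stands for a contradiction: a strict sign was deduced where the table holds the opposite
    sign or a collinear triple. *)
Definition learn (t : option table) (i j k : nat) (a : orient_info) : option table :=
  match t, a with
  | Some t', (Pos | Neg) =>
    match entry t' i j k, a with
    | Unk, _ => Some (record t' i j k a)
    | Pos, Pos | Neg, Neg => t
    | _, _ => None
    end
  | _, _ => t
  end.

(** For fixed [x] and [y] the orientation at [m] is a convex combination of those at [u] and [v].
    Solving for an end, the orientation at [u] is a positive combination of the one at [m] and the
    opposite of the one at [v], and likewise for [v]. So any two of the three signs may determine
    the third. *)
Fixpoint refine_row (t : option table) (x u m v y : nat) (ru rm rv : seq orient_info) :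
    option table :=
  match ru, rm, rv with
  | a :: ru', b :: rm', c :: rv' =>
    let t := learn t x m y (mid_info a c) in
    let t := learn t x u y (mid_info b (opp_info c)) in
    let t := learn t x v y (mid_info b (opp_info a)) in
    refine_row t x u m v y.+1 ru' rm' rv'
  | _, _, _ => t
  end.

Definition refine_at (b : nat * nat * nat) (t : option table) (x : nat) : option table :=
  let: (u, m, v) := b in
  if t is Some t' then
    refine_row t x u m v 0 (entries t' x u) (entries t' x m) (entries t' x v)
  else None.

Definition refine (n : nat) (t : table) (bs : seq (nat * nat * nat)) : option table :=
  foldl (fun t b => foldl (refine_at b) t (iota 0 n)) (Some t) bs.

(** Both orders of a pair are tested because the invariant [knows] does not include the symmetry of
    the table. The newest points come first, which makes [best_pair] prefer them in a tie. *)
Definition open_pairs (s : state) : seq (nat * nat) :=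
  let n := size (colours s) in
  flatten (map (fun u =>
    pmap (fun v =>
      if eqn (nth 0 (colours s) v) (nth 0 (colours s) u) then
        if unblocked (tab s) u v then
          if unblocked (tab s) v u then Some (u, v) else None
        else None
      else None) (rev (iota 0 u))) (rev (iota 0 n))).

(** Branching on a pair with the fewest candidates keeps the search tree small; a pair without
    candidates cannot be improved on and ends the scan. *)
Fixpoint best_pair (s : state) (b : option (nat * nat * seq nat)) (ps : seq (nat * nat)) :
    option (nat * nat * seq nat) :=
  match ps with
  | [::] => b
  | (u, v) :: ps' =>
    let c := filter (candidate s u v) (iota 0 (size (colours s))) in
    if c is [::] then Some (u, v, c) else
    best_pair s (if b is Some (_, _, c') then
                   if size c < size c' then Some (u, v, c) else b
                 else Some (u, v, c)) ps'
  end.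

Definition add_point (s : state) (k : nat) (R : seq (seq orient_info))
    (b : seq (nat * nat * nat)) : state :=
  State (extend (tab s) R) (rcons (colours s) k) (maxn (ncolours s) k.+1) (b ++ blockings s).

(** Colours that have not appeared yet are interchangeable, so only one of them is tried. *)
Definition next_colours (s : state) : seq nat := iota 0 (minn 4 (ncolours s).+1).

(* [if] instead of [&&] and [||], whose arguments [vm_compute] would evaluate eagerly. *)
Fixpoint refuted (cap fuel : nat) (s : state) : bool :=
  if fuel is fuel'.+1 then
    let n := size (colours s) in
    if best_pair s None (open_pairs s) is Some (u, v, c) then
      if all (fun m => let bs := (u, m, v) :: blockings s in
                if refine n (record (tab s) u m v Lin) bs is Some t
                then refuted cap fuel' (State t (colours s) (ncolours s) bs) else true) c
      then if n < cap then
             let R := blocker_rows (tab s) u v in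
             all (fun k => if eqn k (nth 0 (colours s) u) then true
                           else refuted cap fuel' (add_point s k R [:: (u, n, v)]))
               (next_colours s)
           else true
      else false
    else if n < cap then
      all (fun k => refuted cap fuel' (add_point s k (free_rows n) [::])) (next_colours s)
    else false
  else false.

Definition initial_table : table :=
  map (fun i => map (fun j => map (fun k =>
    if [|| i == j, j == k | i == k] then Deg else Unk) (iota 0 4)) (iota 0 4)) (iota 0 4).

Definition learn_pos (t : table) (p : nat * nat * nat) : table :=
  let: (i, j, k) := p in record t i j k Pos.

Definition initial_state (ps : seq (nat * nat * nat)) : state :=
  State (foldl learn_pos initial_table ps) [:: 0; 0; 0; 0] 1 [::].

(** A convex quadrilateral, its vertices in counterclockwise order. *)
Definition convex_start := [:: (0, 1, 2); (1, 2, 3); (2, 3, 0); (3, 0, 1)].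

(** A counterclockwise triangle 0, 1, 2 with the point 3 in its interior. *)
Definition nested_start := [:: (0, 1, 2); (0, 1, 3); (1, 2, 3); (2, 0, 3)].

(** The cap 13 is the number of points of the set to be excluded. The fuel 60 bounds the depth of
    the recursion; running out of fuel counts as failure, so it only has to be large enough. *)
Lemma convex_refuted : refuted 13 60 (initial_state convex_start).
Proof. by vm_compute. Qed.

Lemma nested_refuted : refuted 13 60 (initial_state nested_start).
Proof. by vm_compute. Qed.

Local Open Scope ring_scope.

(** * Orientation and betweenness in the plane *)

Section Plane.
Variable R : realType.
Implicit Types p q r u v w x y z : 'rV[R]_2.

(** Twice the signed area of the triangle, positive when it is counterclockwise. *)
Definition orient p q r : R :=
  (q 0 0 - p 0 0) * (r 0 1 - p 0 1) - (q 0 1 - p 0 1) * (r 0 0 - p 0 0).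

Lemma orient_rot p q r : orient q r p = orient p q r.
Proof. by rewrite /orient; ring. Qed.

Lemma orient_rotr p q r : orient r p q = orient p q r.
Proof. by rewrite -orient_rot. Qed.

Lemma orient_swap p q r : orient p r q = - orient p q r.
Proof. by rewrite /orient; ring. Qed.

Lemma orient_same p q : orient p q q = 0.
Proof. by rewrite /orient; ring. Qed.

Lemma orient_mid (t : R) x u v y :
  orient x ((1 - t) *: u + t *: v) y = (1 - t) * orient x u y + t * orient x v y.
Proof. by rewrite /orient !mxE; ring. Qed.

(** Additivity of signed area: [z] cuts the triangle into three signed triangles. *)
Lemma orient4 p q r z : orient p q r = orient z q r + orient p z r + orient p q z.
Proof. by rewrite /orient; ring. Qed.

Lemma plane_eq p q : p 0 0 = q 0 0 -> p 0 1 = q 0 1 -> p = q.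
Proof.
move=> e0 e1; apply/rowP => j.
by have [->|->] : j = 0 \/ j = 1 by case: j => [[|[|]]] // lt; [left|right]; apply: val_inj.
Qed.

Lemma blocks_sym x v w : blocks x v w -> blocks x w v.
Proof.
case=> t [/andP[t0 t1] ->]; exists (1 - t); split; first by apply/andP; split; lra.
by apply: plane_eq; rewrite !mxE; ring.
Qed.

Lemma blocks_nondeg x v w : v <> w -> blocks x v w -> x <> v.
Proof.
move=> vw [t [/andP[t0 _] xE]] xv; apply: vw; move: xE; rewrite {x}xv => /rowP vE.
have eq_at j : v 0 j = w 0 j.
  have := vE j; rewrite !mxE => e.
  have : t * (v 0 j - w 0 j) = 0 by lra.
  by move/eqP; rewrite mulf_eq0 (gt_eqF t0) subr_eq0 => /eqP.
exact: plane_eq.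
Qed.

Lemma orient_blocks x v w : blocks x v w -> orient v x w = 0.
Proof. by case=> t [_ ->]; rewrite orient_mid orient_same /orient; ring. Qed.

Lemma blocks_inner m p q r : blocks m p q -> blocks q p r -> blocks m p r.
Proof.
move=> [t [/andP[t0 t1] ->]] [s [/andP[s0 s1] ->]].
exists (t * s); split; first by apply/andP; split; nra.
by apply: plane_eq; rewrite !mxE; ring.
Qed.

Lemma blocks_outer m p q r : blocks m p q -> blocks q p r -> blocks q m r.
Proof.
move=> [t [/andP[t0 t1] ->]] [s [/andP[s0 s1] ->]].
have d0 : 0 < 1 - t * s by nra.
(* With [p] at 0 and [r] at 1 on the line, [q] is at [s] and the blocker of [p] and [q] at [t * s];
   this is the position of [q] on the way from that blocker to [r]. *)
exists ((s - t * s) / (1 - t * s)); split.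
  by apply/andP; split; [rewrite divr_gt0 //; nra|rewrite ltr_pdivrMr //; nra].
by apply: plane_eq; rewrite !mxE; field; lra.
Qed.

(** Both [r] and [s] lie on the same side of [p], namely that of [q]. *)
Lemma blocks_twice p q r s : p <> q -> blocks r p q -> blocks s p q -> ~ blocks p r s.
Proof.
move=> pq [t [/andP[t0 t1] ->]] [t' [/andP[t'0 t'1] ->]] [w [/andP[w0 w1] /rowP pE]].
apply: pq; have k0 : 0 < (1 - w) * t + w * t' by nra.
have eq_at j : p 0 j = q 0 j.
  have := pE j; rewrite !mxE => e.
  have : ((1 - w) * t + w * t') * (p 0 j - q 0 j) = 0 by nra.
  by move/eqP; rewrite mulf_eq0 (gt_eqF k0) subr_eq0 => /eqP.
exact: plane_eq.
Qed.

Lemma collinear_blocks p q r : p <> q -> p <> r -> q <> r -> orient p q r = 0 ->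
  blocks p q r \/ blocks q p r \/ blocks r p q.
Proof.
move=> pq pr qr; rewrite /orient => o0.
have [s [s0E s1E]] : exists s : R, r 0 0 = (1 - s) * p 0 0 + s * q 0 0
    /\ r 0 1 = (1 - s) * p 0 1 + s * q 0 1.
  (* The parameter is computed from a coordinate in which [p] and [q] differ. *)
  have [e0|n0] := eqVneq (q 0 0) (p 0 0).
    have n1 : q 0 1 - p 0 1 != 0.
      by apply/eqP => e1; apply: pq; apply: plane_eq; lra.
    exists ((r 0 1 - p 0 1) / (q 0 1 - p 0 1)); split; last by field.
    move/eqP: o0; rewrite e0 subrr mul0r sub0r oppr_eq0 mulf_eq0 (negbTE n1) /= subr_eq0.
    by move=> /eqP ->; field.
  have {}n0 : q 0 0 - p 0 0 != 0 by rewrite subr_eq0.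
  exists ((r 0 0 - p 0 0) / (q 0 0 - p 0 0)); split; first by field.
  apply: (mulfI n0).
  have -> : (q 0 0 - p 0 0) * r 0 1
      = (q 0 1 - p 0 1) * (r 0 0 - p 0 0) + (q 0 0 - p 0 0) * p 0 1 by lra.
  by field.
have s0 : s != 0 by apply/eqP => e; apply: pr; apply: plane_eq; rewrite ?s0E ?s1E e; ring.
have s1 : s != 1 by apply/eqP => e; apply: qr; apply: plane_eq; rewrite ?s0E ?s1E e; ring.
(* On the line with [p] at 0 and [q] at 1, the position [s] of [r] tells which point is in the
   middle: [p] if it is negative, [r] if it is between 0 and 1, [q] if it exceeds 1. *)
have [sn|sp] := ltP s 0.
  left; exists (1 - s)^-1; split.
    have d0 : 0 < 1 - s by lra.
    by rewrite invr_gt0 d0 invf_lt1 //=; lra.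
  by apply: plane_eq; rewrite !mxE ?s0E ?s1E; field; rewrite subr_eq0 eq_sym.
have {}sp : 0 < s by rewrite lt_def s0.
have [sn|sp'] := ltP s 1.
  right; right; exists s; split; first by rewrite sp.
  by apply: plane_eq; rewrite !mxE.
have {}sp' : 1 < s by rewrite lt_def s1.
right; left; exists s^-1; split; first by rewrite invr_gt0 sp invf_lt1.
by apply: plane_eq; rewrite !mxE ?s0E ?s1E; field.
Qed.

End Plane.

(** * Colours on a line *)

Lemma argmin_seq (R : realType) (T : eqType) (s : seq T) (Q : T -> Prop) (g : T -> R) :
  (exists2 x, x \in s & Q x) ->
  exists x, [/\ x \in s, Q x & forall y, y \in s -> Q y -> g x <= g y].
Proof.
elim: s => [[x]|a s IH [x]]; first by rewrite in_nil.
have [sQ _ _|sQ] := EM (exists2 x, x \in s & Q x).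
  have [y [ys Qy min_y]] := IH sQ.
  have [[Qa ay]|nay] := EM (Q a /\ g a <= g y).
    exists a; split; rewrite ?mem_head // => z; rewrite inE => /predU1P[->|zs Qz] //.
    exact: le_trans ay (min_y z zs Qz).
  exists y; split; rewrite ?inE ?ys ?orbT // => z /predU1P[-> Qa|]; last exact: min_y.
  by have [ay|/ltW //] := leP (g a) (g y); case: nay.
rewrite inE => /predU1P[->|xs] Qx; last by case: sQ; exists x.
exists a; split; rewrite ?mem_head // => z; rewrite inE => /predU1P[->|zs Qz] //.
by case: sQ; exists z.
Qed.

(** Here the colouring is defined on the whole plane, so that it need not be changed when points are
    removed from [P]. *)
Definition blocked_by (R : realType) (P : seq 'rV[R]_2) (col : 'rV[R]_2 -> 'I_4) : Prop :=
  forall v w, v \in P -> w \in P -> v <> w ->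
    (col v = col w <-> exists2 x, x \in P & blocks x v w).

Section Colouring.
Variables (R : realType) (P : seq 'rV[R]_2) (col : 'rV[R]_2 -> 'I_4).
Hypothesis blockedP : blocked_by P col.
Implicit Types p q r s v w x y z : 'rV[R]_2.

Lemma blocks_ends x v w : x \in P -> v \in P -> w \in P -> v <> w -> blocks x v w -> col v = col w.
Proof. by move=> xP vP wP vw xvw; apply/blockedP => //; exists x. Qed.

(* Otherwise [v] and [x] have a blocker; the one nearest to [v] has the colour of [w], hence
   that of [v], which requires a blocker still nearer to [v]. *)
Lemma blocks_col x v w : x \in P -> v \in P -> w \in P -> v <> w -> blocks x v w -> col x <> col v.
Proof.
move=> xP vP wP vw xvw; have xv := blocks_nondeg vw xvw => /esym vx.
pose g y := (y 0 0 - v 0 0) * (w 0 0 - v 0 0) + (y 0 1 - v 0 1) * (w 0 1 - v 0 1).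
have gw : 0 < g w.
  rewrite /g -!expr2 lt_def addr_ge0 ?sqr_ge0 // andbT paddr_eq0 ?sqr_ge0 // !sqrf_eq0.
  rewrite !subr_eq0; apply/negP => /andP[/eqP e0 /eqP e1].
  by apply: vw; apply: plane_eq.
have g_scale y z t : y = (1 - t) *: v + t *: z -> g y = t * g z.
  by move=> ->; rewrite /g !mxE; ring.
have g_pos y z : blocks y v z -> 0 < g z -> 0 < g y < g z.
  by move=> [t [/andP[t0 t1] /g_scale ->]] gz; apply/andP; split; nra.
have [y [yP yvx ymin]] : exists y, [/\ y \in P, blocks y v x &
    forall y', y' \in P -> blocks y' v x -> g y <= g y'].
  by apply: argmin_seq; apply/blockedP => // vx'; apply: xv.
have /andP[gx _] := g_pos _ _ xvw gw.
have /andP[gy gyx] := g_pos _ _ yvx gx.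
have yv : v <> y by move=> e; apply: (@blocks_nondeg _ y v x) => //; exact/nesym.
have xyw := blocks_outer yvx xvw.
have yw : y <> w.
  by move=> yw; have /andP[_] := g_pos _ _ xvw gw; rewrite -yw ltNge (ltW gyx).
have cy : col v = col y by rewrite (blocks_ends xP yP wP yw xyw); exact: blocks_ends xvw.
have [y' y'P y'vy] : exists2 y', y' \in P & blocks y' v y by apply/blockedP.
have := ymin _ y'P (blocks_inner y'vy yvx).
by have /andP[_] := g_pos _ _ y'vy gy; rewrite ltNge => /negP.
Qed.

(** Three vectors of the plane satisfy a linear relation whose coefficients are their pairwise
    determinants. Here it makes [orient p r s] times the nonzero vector from [p] to [q] vanish. *)
Lemma orient_trans p q r s : p <> q -> orient p q r = 0 -> orient p q s = 0 -> orient p r s = 0.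
Proof.
move=> pq r0 s0; apply/eqP; have [//|n0] := boolP (orient p r s == 0).
have e0 : (q 0 0 - p 0 0) * orient p r s
    = (r 0 0 - p 0 0) * orient p q s - (s 0 0 - p 0 0) * orient p q r.
  by rewrite /orient; ring.
have e1 : (q 0 1 - p 0 1) * orient p r s
    = (r 0 1 - p 0 1) * orient p q s - (s 0 1 - p 0 1) * orient p q r.
  by rewrite /orient; ring.
case: pq; apply: plane_eq; apply/esym/eqP; rewrite -subr_eq0 -(mulIr_eq0 _ (mulIf n0)).
  by rewrite e0 r0 s0 !mulr0 subrr.
by rewrite e1 r0 s0 !mulr0 subrr.
Qed.

(** The ends [p] and [q] share a colour, so neither blocks the other from [s], and a collinear [s]
    would also be between them. Then one of [r], [s] blocks [p] from the other, which therefore has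
    the colour of [p]; but a blocker of [p] and [q] has a different colour. *)
Lemma no4_mid p q r s : p \in P -> q \in P -> r \in P -> s \in P ->
  uniq [:: p; q; r; s] -> blocks r p q -> orient p q s <> 0.
Proof.
move=> pP qP rP sP; rewrite /= !inE !negb_or => /and4P[/and3P[/eqP pq /eqP pr /eqP ps]].
move=> /andP[/eqP qr /eqP qs] /eqP rs _ rpq spq0.
have cpq := blocks_ends rP pP qP pq rpq; have crp := blocks_col rP pP qP pq rpq.
have prs0 := orient_trans pq (etrans (orient_swap _ _ _) _) spq0.
have [pqs|[qps|spq]] := collinear_blocks pq ps qs spq0.
- by apply: (blocks_col pP qP sP qs pqs).
- by apply: (blocks_col qP pP sP ps qps).
have csp := blocks_col sP pP qP pq spq.
have {}prs0 : orient p r s = 0 by apply: prs0; rewrite orient_blocks // oppr0.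
have [prs|[rps|spr]] := collinear_blocks pr ps rs prs0.
- exact: blocks_twice pq rpq spq prs.
- by apply: csp; rewrite (blocks_ends rP pP sP ps rps).
- by apply: crp; rewrite (blocks_ends sP pP rP pr spr).
Qed.

Lemma no4 p q r s : p \in P -> q \in P -> r \in P -> s \in P ->
  uniq [:: p; q; r; s] -> orient p q r = 0 -> orient p q s <> 0.
Proof.
move=> pP qP rP sP U; have := U.
rewrite /= !inE !negb_or => /and4P[/and3P[/eqP pq /eqP pr /eqP ps]].
move=> /andP[/eqP qr /eqP qs] /eqP rs _ r0 s0.
have prs := orient_trans pq r0 s0.
have qrs : orient q r s = 0.
  by have := orient4 p q r s; rewrite -(orient_rot s q r) (orient_swap p r s); lra.
have [pqr|[qpr|rpq]] := collinear_blocks pq pr qr r0.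
- apply: (no4_mid qP rP pP sP _ pqr qrs).
  by rewrite (@perm_uniq _ _ [:: p; q; r; s]) //; apply/permP => a /=; lia.
- apply: (no4_mid pP rP qP sP _ qpr prs).
  by rewrite (@perm_uniq _ _ [:: p; q; r; s]) //; apply/permP => a /=; lia.
- exact: (no4_mid pP qP rP sP U rpq).
Qed.

End Colouring.

(** * Soundness of the search *)

Lemma nth_update (A : Type) (d : A) f s i j : nth d (update f s i) j =
  if (j == i) && (i < size s)%N then f (nth d s i) else nth d s j.
Proof.
by elim: s i j => [|a s IH] [|i] [|j] //=; rewrite ?andbF ?IH ?eqSS ?ltnS.
Qed.

Lemma size_update (A : Type) f (s : seq A) i : size (update f s i) = size s.
Proof. by elim: s i => [|a s IH] [|i] //=; rewrite IH. Qed.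

Lemma size_map_pair (A B C : Type) (f : A -> B -> C) s r :
  size s = size r -> size (map_pair f s r) = size s.
Proof. by elim: s r => [|a s IH] [|b r] //= [/IH ->]. Qed.

Lemma nth_map_pair (A B C : Type) (f : A -> B -> C) a b c s r i :
  size s = size r -> (i < size s)%N -> nth c (map_pair f s r) i = f (nth a s i) (nth b r i).
Proof. by elim: s r i => [|a' s IH] [|b' r] [|i] //= [/IH/[apply] ->]. Qed.

Definition cube (n : nat) (t : table) : Prop :=
  size t = n /\ forall i, (i < n)%N ->
    size (nth [::] t i) = n /\ forall j, (j < n)%N -> size (entries t i j) = n.

Lemma cube_set_entry n t i j k a : cube n t -> cube n (set_entry t i j k a).
Proof.
rewrite /cube /entries /set_entry => -[sz H]; rewrite size_update; split=> // i' i'n.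
have [s1 s2] := H i' i'n; rewrite nth_update; case: ifP => [/andP[/eqP ei _]|_]; last by [].
rewrite size_update -ei; split=> // j' j'n.
by rewrite nth_update; case: ifP => [/andP[/eqP ej _]|_]; rewrite ?size_update -?ej s2.
Qed.

(** The first alternative includes writing out of range, which changes nothing; so no bound on the
    indices is required. *)
Lemma entry_set_entry t i j k a i' j' k' :
  entry (set_entry t i j k a) i' j' k' = entry t i' j' k' \/
  [/\ i' = i, j' = j, k' = k & entry (set_entry t i j k a) i' j' k' = a].
Proof.
rewrite /entry /entries /set_entry nth_update; case: ifP => [/andP[/eqP -> _]|_]; last by left.
rewrite nth_update; case: ifP => [/andP[/eqP -> _]|_]; last by left.
by rewrite nth_update; case: ifP => [/andP[/eqP -> _]|_]; [right|left].
Qed.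

Local Notation pt ps i := (nth 0 ps i).

(** * Meaning of the table and soundness of the sign deductions *)

Section Meaning.
Variable R : realType.
Implicit Types (x y z : 'rV[R]_2) (ps : seq 'rV[R]_2).

Definition sign_of (a : orient_info) (d : R) : Prop :=
  match a with Unk => True | Pos => 0 < d | Neg => d < 0 | Lin | Deg => d = 0 end.

(** Signs alone do not separate [Lin] from [Deg]; the distinctness carried by [Lin] is what allows
    [no4] to be applied. *)
Definition holds (a : orient_info) x y z : Prop :=
  sign_of a (orient x y z) /\ (a = Lin -> uniq [:: x; y; z]).

Lemma sign_of_opp a d : sign_of a d -> sign_of (opp_info a) (- d).
Proof. by case: a => //=; rewrite ?oppr_gt0 ?oppr_lt0 // => ->; rewrite oppr0. Qed.

Lemma sign_of_mid (t : R) a c (d e : R) : 0 < t < 1 ->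
  sign_of a d -> sign_of c e -> sign_of (mid_info a c) ((1 - t) * d + t * e).
Proof. by move=> /andP[t0 t1]; case: a; case: c => //= Ha Hc; nra. Qed.

Lemma sign_of_end (t : R) b c (d e f : R) : 0 < t < 1 -> f = (1 - t) * d + t * e ->
  sign_of b f -> sign_of c e -> sign_of (mid_info b (opp_info c)) d.
Proof. by move=> /andP[t0 t1]; case: b; case: c => //= fE Hb Hc; nra. Qed.

Lemma holds_rot a x y z : holds a x y z -> holds a y z x.
Proof. by case=> s u; split=> [|/u]; [rewrite orient_rot|rewrite -(rot_uniq 1)]. Qed.

Lemma holds_swap a x y z : holds a x y z -> holds (opp_info a) x z y.
Proof.
case=> s u; split; first by rewrite orient_swap; apply: sign_of_opp.
move=> e; have {e}/u : a = Lin by case: (a) e.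
by rewrite (@perm_uniq _ [:: x; z; y] [:: x; y; z]) //; apply/permP => b /=; lia.
Qed.

Definition knows (t : table) ps : Prop := cube (size ps) t /\
  forall i j k, (i < size ps)%N -> (j < size ps)%N -> (k < size ps)%N ->
    holds (entry t i j k) (pt ps i) (pt ps j) (pt ps k).

Lemma knows_set_entry t ps i j k a :
  knows t ps -> holds a (pt ps i) (pt ps j) (pt ps k) -> knows (set_entry t i j k a) ps.
Proof.
move=> [C K] H; split; first exact: cube_set_entry.
move=> i' j' k' i'n j'n k'n.
by have [->|[-> -> -> ->]] := entry_set_entry t i j k a i' j' k'; first exact: K.
Qed.

Lemma knows_record t ps i j k a :
  knows t ps -> holds a (pt ps i) (pt ps j) (pt ps k) -> knows (record t i j k a) ps.
Proof.
move=> K H; have H2 := holds_rot H; have H3 := holds_rot H2.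
have G := holds_swap H; have G2 := holds_rot G; have G3 := holds_rot G2.
by rewrite /record; do 6! apply: knows_set_entry => //.
Qed.

Definition option_knows (t : option table) ps : Prop := if t is Some t' then knows t' ps else False.

Lemma option_knows_learn t ps i j k a :
  (i < size ps)%N -> (j < size ps)%N -> (k < size ps)%N -> option_knows t ps ->
  sign_of a (orient (pt ps i) (pt ps j) (pt ps k)) -> option_knows (learn t i j k a) ps.
Proof.
case: t => // t i_lt j_lt k_lt K; have /= := K => -[_ H] S.
have [s _] := H _ _ _ i_lt j_lt k_lt.
case: a S => //= S; case: (entry t i j k) s => //= s; try by [exact: K|lra].
  by apply: knows_record => //; split.
by apply: knows_record => //; split.
Qed.

(** The three rows are what remains, from column [y] on, of rows read before the pass, while [t]
    changes during it. Hence their entries are related to the points directly and not to [t]. *)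
Lemma refine_row_sound t ps (x u m v y : nat) ru rm rv : option_knows t ps ->
  (x < size ps)%N -> (u < size ps)%N -> (m < size ps)%N -> (v < size ps)%N ->
  blocks (pt ps m) (pt ps u) (pt ps v) -> (y + size ru <= size ps)%N ->
  (forall i, (i < size ru)%N ->
    sign_of (nth Unk ru i) (orient (pt ps x) (pt ps u) (pt ps (y + i)))) ->
  (forall i, (i < size rm)%N ->
    sign_of (nth Unk rm i) (orient (pt ps x) (pt ps m) (pt ps (y + i)))) ->
  (forall i, (i < size rv)%N ->
    sign_of (nth Unk rv i) (orient (pt ps x) (pt ps v) (pt ps (y + i)))) ->
  option_knows (refine_row t x u m v y ru rm rv) ps.
Proof.
move=> K x_lt u_lt m_lt v_lt [s [s01 mE]].
elim: ru rm rv y t K => [|a ru IH] [|b rm] [|c rv] y t K //= y_le Ha Hb Hc.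
have y_lt : (y < size ps)%N by lia.
have := Ha 0%N isT; have := Hb 0%N isT; have := Hc 0%N isT; rewrite /= addn0.
set ou := orient _ (pt ps u) _; set om := orient _ (pt ps m) _; set ov := orient _ (pt ps v) _.
move=> Sc Sb Sa; have omE : om = (1 - s) * ou + s * ov by rewrite /om mE orient_mid.
apply: IH.
- apply: option_knows_learn => //; first (apply: option_knows_learn => //; first
    apply: option_knows_learn => //).
  + by rewrite -/om omE; apply: sign_of_mid.
  + exact: sign_of_end s01 omE Sb Sc.
  + apply: (@sign_of_end (1 - s) _ _ _ ou om) => //.
      by case/andP: s01 => *; apply/andP; split; lra.
    by rewrite -/ov omE; ring.
- by lia.
- by move=> i i_lt; rewrite addSnnS; apply: (Ha i.+1).
- by move=> i i_lt; rewrite addSnnS; apply: (Hb i.+1).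
- by move=> i i_lt; rewrite addSnnS; apply: (Hc i.+1).
Qed.

Definition is_blocking ps (b : nat * nat * nat) : Prop := let: (u, m, v) := b in
  [/\ (u < size ps)%N, (m < size ps)%N, (v < size ps)%N & blocks (pt ps m) (pt ps u) (pt ps v)].

Lemma refine_sound t ps bs : knows t ps -> (forall b, b \in bs -> is_blocking ps b) ->
  option_knows (refine (size ps) t bs) ps.
Proof.
rewrite /refine => K; have {K} : option_knows (Some t) ps by [].
elim: bs (Some t) => [|b bs IH] ot K Hb //=; apply: IH; last first.
  by move=> b' b'bs; apply: Hb; rewrite inE b'bs orbT.
have: is_blocking ps b by apply: Hb; rewrite mem_head.
have : {in iota 0 (size ps), forall x : nat, (x < size ps)%N} by move=> x; rewrite mem_iota.
case: b {Hb} => [[u m] v]; elim: (iota 0 _) ot K => [|x xs IHx] ot K //= Hx H.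
apply: IHx => //; last by move=> x' x'xs; apply: Hx; rewrite inE x'xs orbT.
have x_lt : (x < size ps)%N by apply: Hx; rewrite mem_head.
case: ot K => // t' K; case: H => u_lt m_lt v_lt umv.
have [[_ C] E] := K; have [_ S] := C x x_lt.
have entriesP w i : (w < size ps)%N -> (i < size (entries t' x w))%N ->
    sign_of (nth Unk (entries t' x w) i) (orient (pt ps x) (pt ps w) (pt ps (0 + i))).
  by move=> w_lt; rewrite S // => i_lt; have [] := E x w i x_lt w_lt i_lt.
by apply: refine_row_sound => //= [|i|i|i]; [rewrite S|exact: entriesP..].
Qed.

End Meaning.

(** * Adding a point to the table *)

Section Extension.
Variable R : realType.
Implicit Types (ps : seq 'rV[R]_2).

Definition describes_new (rows : seq (seq orient_info)) ps (z : 'rV[R]_2) : Prop :=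
  size rows = size ps /\ forall i, (i < size ps)%N ->
    size (nth [::] rows i) = size ps /\ forall k, (k < size ps)%N ->
      holds (nth Unk (nth [::] rows i) k) (pt ps i) z (pt ps k).

Lemma cube_extend n t (rows : seq (seq orient_info)) : cube n t -> size rows = n ->
  (forall i, (i < n)%N -> size (nth [::] rows i) = n) -> cube n.+1 (extend t rows).
Proof.
move=> [st Ct] sR SR; have e : size t = size rows by rewrite st sR.
rewrite /cube /entries /extend size_rcons size_map_pair // st; split=> // i; rewrite ltnS => i_le.
rewrite nth_rcons size_map_pair // st; have [i_lt|i_ge] := ltnP i n; last first.
  have -> : i = n by lia.
  rewrite eqxx size_rcons size_map sR; split=> // j; rewrite ltnS => j_le.
  rewrite nth_rcons size_map sR; have [j_lt|j_ge] := ltnP j n.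
    by rewrite (nth_map [::]) ?sR // size_rcons size_map SR.
  by have -> : j = n by [lia]; rewrite eqxx size_nseq.
have [si Ci] := Ct i i_lt; rewrite (nth_map_pair _ [::] [::]) ?st //.
rewrite size_rcons size_map_pair ?SR // si; split=> // j; rewrite ltnS => j_le.
rewrite nth_rcons size_map_pair ?SR // si; have [j_lt|j_ge] := ltnP j n.
  rewrite (nth_map_pair _ [::] Unk) ?SR ?si // size_rcons.
  by have := Ci j j_lt; rewrite /entries => ->.
by have -> : j = n by [lia]; rewrite eqxx size_rcons SR.
Qed.

Lemma holds_deg (x y z : 'rV[R]_2) : orient x y z = 0 -> holds Deg x y z.
Proof. by []. Qed.

Lemma knows_extend t ps (rows : seq (seq orient_info)) z :
  knows t ps -> describes_new rows ps z -> knows (extend t rows) (rcons ps z).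
Proof.
move=> [C K] [sR H]; rewrite /knows size_rcons.
have SR i : (i < size ps)%N -> size (nth [::] rows i) = size ps by case/H.
have [st Ct] := C; have e : size t = size rows by rewrite st sR.
split; first exact: cube_extend.
have last_pt : pt (rcons ps z) (size ps) = z by rewrite nth_rcons ltnn eqxx.
have old_pt i : (i < size ps)%N -> pt (rcons ps z) i = pt ps i by rewrite nth_rcons => ->.
move=> i j k; rewrite !ltnS /entry /entries /extend nth_rcons size_map_pair // st => i_le j_le k_le.
have [i_lt|i_ge] := ltnP i (size ps); last first.
  have -> : i = size ps by lia.
  rewrite eqxx last_pt nth_rcons size_map sR; have [j_lt|j_ge] := ltnP j (size ps); last first.
    have -> : j = size ps by lia.
    by rewrite eqxx last_pt nth_nseq ltnS k_le; apply: holds_deg; rewrite /orient; ring.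
  rewrite (nth_map [::]) ?sR // nth_rcons size_map SR // old_pt //.
  have [k_lt|k_ge] := ltnP k (size ps); last first.
    have -> : k = size ps by lia.
    by rewrite eqxx last_pt; apply: holds_deg; rewrite /orient; ring.
  rewrite (nth_map Unk) ?SR // old_pt //; have [_ /(_ k k_lt) Hjk] := H j j_lt.
  by do 2! apply: holds_rot; apply: holds_swap.
have [si Ci] := Ct i i_lt; rewrite (nth_map_pair _ [::] [::]) ?st // old_pt //.
rewrite nth_rcons size_map_pair ?SR // si; have [j_lt|j_ge] := ltnP j (size ps); last first.
  have -> : j = size ps by lia.
  rewrite eqxx last_pt nth_rcons SR //; have [k_lt|k_ge] := ltnP k (size ps).
    by rewrite old_pt //; have [_ /(_ k k_lt)] := H i i_lt.
  have -> : k = size ps by lia.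
  by rewrite eqxx last_pt; apply: holds_deg; rewrite orient_same.
rewrite (nth_map_pair _ [::] Unk) ?SR ?si // nth_rcons old_pt //.
have := Ci j j_lt; rewrite /entries => ->.
have [k_lt|k_ge] := ltnP k (size ps); first by rewrite old_pt //; apply: K.
have -> : k = size ps by lia.
by rewrite eqxx last_pt; apply: holds_swap; have [_ /(_ j j_lt)] := H i i_lt.
Qed.

Lemma mid_not_lin a b : mid_info a b <> Lin.
Proof. by case: a; case: b. Qed.

Lemma describes_free ps z : describes_new (free_rows (size ps)) ps z.
Proof.
rewrite /free_rows; split=> [|i i_lt]; first by rewrite size_map size_iota.
rewrite (nth_map 0%N) ?size_iota // nth_iota // add0n size_update size_nseq; split=> // k k_lt.
rewrite nth_update size_nseq; case: ifP => [/andP[/eqP -> _]|_]; last by rewrite nth_nseq k_lt.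
by apply: holds_deg; rewrite /orient; ring.
Qed.

Lemma describes_blocker t ps u v z : knows t ps -> z \notin ps -> uniq ps -> u != v ->
  (u < size ps)%N -> (v < size ps)%N -> blocks z (pt ps u) (pt ps v) ->
  describes_new (blocker_rows t u v) ps z.
Proof.
move=> [[st Ct] K] zps Ups uv u_lt v_lt zuv.
rewrite /blocker_rows; set rows := map _ t.
have sR : size rows = size ps by rewrite size_map st.
have old : describes_new rows ps z.
  split=> // i i_lt; rewrite (nth_map [::]) ?st //; have [si Ci] := Ct i i_lt.
  have := Ci u u_lt; have := Ci v v_lt; rewrite /entries => sv su.
  rewrite size_map_pair ?su ?sv //; split=> // k k_lt; rewrite (nth_map_pair _ Unk Unk) ?su ?sv //.
  split=> [|/mid_not_lin //]; case: zuv => s [s01 ->]; rewrite orient_mid.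
  have [Su _] := K i u k i_lt u_lt k_lt; have [Sv _] := K i v k i_lt v_lt k_lt.
  exact: sign_of_mid.
have lin i j : (i < size ps)%N -> (j < size ps)%N -> i != j -> blocks z (pt ps i) (pt ps j) ->
    holds Lin (pt ps i) z (pt ps j).
  move=> i_lt j_lt ij zij; split; first exact: orient_blocks.
  rewrite /= !inE nth_uniq // (negbTE ij) orbF andbT => _; apply/andP.
  by split; apply: contraNneq zps => ez; [rewrite -ez|rewrite ez]; apply: mem_nth.
have step rows' i j : describes_new rows' ps z -> (i < size ps)%N -> (j < size ps)%N -> i != j ->
    blocks z (pt ps i) (pt ps j) ->
    describes_new (update (fun r => update (fun=> Lin) r j) rows' i) ps z.
  move=> [sR' H] i_lt j_lt ij zij; split=> [|i' i'_lt]; first by rewrite size_update.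
  have [s1 H1] := H i' i'_lt; rewrite nth_update; case: ifP => [/andP[/eqP ei _]|_]; last by [].
  rewrite size_update -ei; split=> // k k_lt; rewrite nth_update.
  by case: ifP => [/andP[/eqP -> _]|_]; [rewrite ei; apply: lin|exact: H1].
by apply: (step _ v u) => //; [apply: (step _ u v)|rewrite eq_sym|apply: blocks_sym].
Qed.

End Extension.

Lemma unblockedP t u v m : unblocked t u v -> entry t u m v <> Lin.
Proof.
rewrite /unblocked -all_predC /entry /entries => /(all_nthP [::]) H e.
have [m_lt|m_ge] := ltnP m (size (nth [::] t u)).
  by have := H _ m_lt; rewrite /= e.
by move: e; rewrite (nth_default _ m_ge) nth_nil.
Qed.

Definition incompatible (a b c : orient_info) : bool :=
  match a, b, c with
  | Lin, _, _ | _, Lin, _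
  | Pos, Pos, _ | Neg, Neg, _ | Pos, _, Neg | Neg, _, Pos | _, Pos, Pos | _, Neg, Neg => true
  | _, _, _ => false
  end.

Lemma compatibleP r1 r2 r3 : (forall w, (w < size r1)%N ->
  ~~ incompatible (nth Unk r1 w) (nth Unk r2 w) (nth Unk r3 w)) -> compatible r1 r2 r3.
Proof.
elim: r1 r2 r3 => [|a r1 IH] [|b r2] [|c r3] //= H.
have {}IH : compatible r1 r2 r3 by apply: IH => w w_lt; apply: (H w.+1).
by have := H 0%N isT; case: a {H} => //; case: b => //; case: c.
Qed.

Lemma best_pairP s ps b u v c : best_pair s b ps = Some (u, v, c) ->
  b = Some (u, v, c) \/
  (u, v) \in ps /\ c = filter (candidate s u v) (iota 0 (size (colours s))).
Proof.
elim: ps b => [|[u' v'] ps IH] b /=; first by left.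
set c' := filter (candidate s u' v') _.
case ec: c' => [|m c''] => [[<- <- <-]|]; first by right; rewrite mem_head -ec.
rewrite -ec => /IH[]; last by move=> [uv ->]; right; rewrite inE uv orbT.
have new : Some (u', v', c') = Some (u, v, c) -> b = Some (u, v, c) \/
    (u, v) \in (u', v') :: ps /\ c = filter (candidate s u v) (iota 0 (size (colours s))).
  by case=> <- <- <-; right; rewrite mem_head.
by case: b new => [[[u0 v0] c0]|] // new; case: ifP => // _; left.
Qed.

Lemma open_pairsP s u v : (u, v) \in open_pairs s ->
  [/\ (v < u)%N, (u < size (colours s))%N, nth 0%N (colours s) v = nth 0%N (colours s) u,
      unblocked (tab s) u v & unblocked (tab s) v u].
Proof.
rewrite /open_pairs => /flatten_mapP[u' u'_lt]; rewrite mem_pmap => /mapP[v' v'_lt].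
move: u'_lt v'_lt; rewrite !mem_rev !mem_iota /= !add0n => u'_lt v'_lt.
by case: eqnP => // ec; case: ifP => // b1; case: ifP => // b2 [-> ->].
Qed.

(** For [m] between [u] and [v] at parameter [t], and [d] the orientation of (u,v,w), those of
    (u,m,w) and (v,m,w) are [t * d] and [- (1 - t) * d]. The terms with 0 are the degenerate triples
    that [orient_mid] produces. *)
Lemma compatible_signs (R : realType) (t d : R) a b c : 0 < t < 1 ->
  sign_of a ((1 - t) * 0 + t * d) -> sign_of b ((1 - t) * - d + t * 0) -> sign_of c d ->
  a <> Lin -> b <> Lin -> ~~ incompatible a b c.
Proof. by move=> /andP[t0 t1]; case: a; case: b; case: c => //= *; nra. Qed.

Lemma is_blocking_new (R : realType) (ps : seq 'rV[R]_2) u v z :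
  (u < size ps)%N -> (v < size ps)%N -> blocks z (pt ps u) (pt ps v) ->
  is_blocking (rcons ps z) (u, size ps, v).
Proof.
move=> u_lt v_lt zuv; rewrite /is_blocking size_rcons !nth_rcons u_lt v_lt ltnn eqxx.
by split=> //; apply: ltnW.
Qed.

(** * The invariant of the search *)

Section Refutation.
Variables (R : realType) (P : seq 'rV[R]_2) (col : 'rV[R]_2 -> 'I_4).
Hypotheses (blockedP : blocked_by P col) (uniqP : uniq P).

(** The list [cs] translates the colour numbers of the search into actual colours: number [k] stands
    for its [k]-th element. *)
Record model (s : state) (ps : seq 'rV[R]_2) (cs : seq 'I_4) : Prop := Model {
  model_sub : {subset ps <= P};
  model_uniq : uniq ps;
  model_size : size (colours s) = size ps;
  model_knows : knows (tab s) ps;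
  model_cuniq : uniq cs;
  model_csize : size cs = ncolours s;
  model_col : forall i, (i < size ps)%N -> (nth 0%N (colours s) i < size cs)%N /\
    col (pt ps i) = nth 0 cs (nth 0%N (colours s) i);
  model_blockings : forall b, b \in blockings s -> is_blocking ps b }.

Lemma model_same_col s ps cs i j : model s ps cs -> (i < size ps)%N -> (j < size ps)%N ->
  nth 0%N (colours s) i = nth 0%N (colours s) j <-> col (pt ps i) = col (pt ps j).
Proof.
move=> M i_lt j_lt; have [ci ei] := model_col M i_lt; have [cj ej] := model_col M j_lt.
split=> [e|]; first by rewrite ei ej e.
by rewrite ei ej => /eqP; rewrite nth_uniq ?(model_cuniq M) // => /eqP.
Qed.

Lemma pt_mem s ps cs i : model s ps cs -> (i < size ps)%N -> pt ps i \in P.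
Proof. by move=> M i_lt; apply/(model_sub M)/mem_nth. Qed.

Lemma pt_neq s ps cs i j : model s ps cs -> (i < size ps)%N -> (j < size ps)%N -> i <> j ->
  pt ps i <> pt ps j.
Proof. by move=> M i_lt j_lt ij /eqP; rewrite nth_uniq ?(model_uniq M) // => /eqP. Qed.

Lemma candidate_sound s ps cs u v m : model s ps cs -> (u, v) \in open_pairs s ->
  (m < size ps)%N -> blocks (pt ps m) (pt ps u) (pt ps v) -> candidate s u v m.
Proof.
move=> M /open_pairsP[vu u_lt _ /unblockedP free_uv /unblockedP free_vu] m_lt muv.
have v_lt : (v < size ps)%N by rewrite -(model_size M); lia.
rewrite (model_size M) in u_lt.
have uv : pt ps u <> pt ps v by apply: (pt_neq M) => //; lia.
have [uP vP mP] : [/\ pt ps u \in P, pt ps v \in P & pt ps m \in P] by split; apply: (pt_mem M).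
have mu : pt ps m <> pt ps u by apply: blocks_nondeg muv.
have mv : pt ps m <> pt ps v by apply: (blocks_nondeg (nesym uv)); apply: blocks_sym.
have cmu := blocks_col blockedP mP uP vP uv muv.
have [[_ C] K] := model_knows M; have [_ Cu] := C u u_lt.
rewrite /candidate; case: eqnP => [/(model_same_col M m_lt u_lt)//|_].
have o0 : orient (pt ps u) (pt ps v) (pt ps m) = 0.
  by rewrite orient_swap (orient_blocks muv) oppr0.
have [s0 _] := K u v m u_lt v_lt m_lt; move: s0; rewrite {1}/entry o0.
have ok : compatible (entries (tab s) u m) (entries (tab s) v m) (entries (tab s) u v).
  apply: compatibleP => w; rewrite (Cu m m_lt) => w_lt.
  have [su lu] := K u m w u_lt m_lt w_lt; have [sv lv] := K v m w v_lt m_lt w_lt.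
  have [sw lw] := K u v w u_lt v_lt w_lt.
  have wP : pt ps w \in P := pt_mem M w_lt.
  (* As the pair is open, a [Lin] here concerns a point [w] other than [v], which would be a fourth
     point on the line through [u], [m] and [v]. *)
  have no_lin_u : entry (tab s) u m w <> Lin.
    move=> e; move: su (lu e); rewrite e /= !inE negb_or => ou /andP[/andP[um uw] /andP[mw _]].
    have wv : w <> v by move=> ewv; apply: (free_uv m); rewrite -ewv.
    have U : uniq [:: pt ps u; pt ps m; pt ps w; pt ps v].
      rewrite /= !inE !negb_or um uw mw /= andbT; apply/and3P; split; apply/eqP => //.
      exact: (pt_neq M).
    by apply: (no4 blockedP uP mP wP vP U ou); apply: orient_blocks.
  have no_lin_v : entry (tab s) v m w <> Lin.
    move=> e; move: sv (lv e); rewrite e /= !inE negb_or => ov /andP[/andP[vm vw] /andP[mw _]].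
    have wu : w <> u by move=> ewu; apply: (free_vu m); rewrite -ewu.
    have U : uniq [:: pt ps v; pt ps m; pt ps w; pt ps u].
      rewrite /= !inE !negb_or vm vw mw /= andbT; apply/and3P; split; apply/eqP => //.
        exact/nesym.
      exact: (pt_neq M).
    by apply: (no4 blockedP vP mP wP uP U ov); apply/orient_blocks/blocks_sym.
  have [t [t01 mE]] := muv.
  move: su sv sw no_lin_u no_lin_v; rewrite /entry mE !orient_mid.
  have -> : orient (pt ps u) (pt ps u) (pt ps w) = 0 by rewrite /orient; ring.
  have -> : orient (pt ps v) (pt ps v) (pt ps w) = 0 by rewrite /orient; ring.
  have -> : orient (pt ps v) (pt ps u) (pt ps w) = - orient (pt ps u) (pt ps v) (pt ps w).
    by rewrite /orient; ring.
  exact: compatible_signs t01.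
by case: (nth _ _ m) => //=; rewrite ltxx.
Qed.

(** The last clause is for [refuted], which does not try the colour of the ends of a segment on its
    new blocker. *)
Lemma add_point_sound s ps cs rows z bs : model s ps cs -> z \in P -> z \notin ps ->
  describes_new rows ps z -> (forall b, b \in bs -> is_blocking (rcons ps z) b) ->
  exists k cs', [/\ k \in next_colours s, model (add_point s k rows bs) (rcons ps z) cs'
    & forall i, (i < size ps)%N -> col z <> col (pt ps i) -> k <> nth 0%N (colours s) i].
Proof.
move=> M zP zps Hrows Hbs.
have card4 (r : seq 'I_4) : uniq r -> (size r <= 4)%N.
  by move=> /card_uniqP <-; apply: leq_trans (max_card _) _; rewrite card_ord.
have [k [cs' [k_next Ucs' Scs' k_lt [ck cs_sub]]]] : exists k cs', [/\ k \in next_colours s,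
    uniq cs', size cs' = maxn (ncolours s) k.+1, (k < size cs')%N & nth 0 cs' k = col z /\
    forall i, (i < size cs)%N -> (i < size cs')%N /\ nth 0 cs' i = nth 0 cs i].
  (* Either the colour of [z] already has a number, or it gets the next one, which is below 4
     because there are only four colours. *)
  have [zcs|zcs] := boolP (col z \in cs).
    exists (index (col z) cs), cs.
    have k_lt : (index (col z) cs < ncolours s)%N by rewrite -(model_csize M) index_mem.
    have := card4 _ (model_cuniq M); rewrite (model_csize M) => c4.
    split; [|exact: model_cuniq M| | |by rewrite nth_index].
    - by rewrite /next_colours mem_iota; lia.
    - by lia.
    - exact: k_lt.
  have U : uniq (rcons cs (col z)) by rewrite rcons_uniq zcs (model_cuniq M).
  exists (size cs), (rcons cs (col z)); have := card4 _ U; rewrite size_rcons (model_csize M) => c4.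
  split; [by rewrite /next_colours mem_iota; lia|by []| |by rewrite ?size_rcons ?(model_csize M)|].
    by rewrite ?size_rcons ?(model_csize M); lia.
  split=> [|i i_lt]; first by rewrite nth_rcons (model_csize M) ltnn eqxx.
  by rewrite nth_rcons (model_csize M) i_lt; split=> //; lia.
exists k, cs'; split=> //.
  split=> //=.
  - by move=> x; rewrite mem_rcons inE => /predU1P[->|/(model_sub M)].
  - by rewrite rcons_uniq zps (model_uniq M).
  - by rewrite !size_rcons (model_size M).
  - by apply: knows_extend => //; apply: model_knows M.
  - move=> i; rewrite size_rcons ltnS !nth_rcons (model_size M) => i_le.
    have [i_lt|i_ge] := ltnP i (size ps); last by have -> : i = size ps by [lia]; rewrite eqxx ck.
    have [ci ->] := model_col M i_lt; by have [? ->] := cs_sub _ ci.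
  - move=> b; rewrite mem_cat => /orP[/Hbs//|/(model_blockings M)].
    case: b => [[u m] v] [u_lt m_lt v_lt umv].
    by split; rewrite ?size_rcons ?nth_rcons ?u_lt ?m_lt ?v_lt //; apply: ltnW.
move=> i i_lt cz ek; apply: cz; have [ci ->] := model_col M i_lt.
by rewrite -ck ek; have [] := cs_sub _ ci.
Qed.

(** At each node the set [P] itself selects a branch: the actual blocker, or an actual further
    point, together with its actual colour. The model extends to that branch, which is refuted with
    less fuel. *)
Lemma refuted_sound fuel s ps cs : refuted (size P) fuel s -> ~ model s ps cs.
Proof.
elim: fuel s ps cs => // fuel IH s ps cs /= ref M; have sz := model_size M.
have le_sz : (size ps <= size P)%N by apply: uniq_leq_size (model_uniq M) (model_sub M).
(* This justifies the cap: once [size P] distinct points are known, no point of [P] is new. *)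
have newP z : z \in P -> z \notin ps -> (size ps < size P)%N.
  move=> zP zps; rewrite ltn_neqAle le_sz andbT; apply: contra zps => /eqP e.
  by have [_ ->] := uniq_min_size (model_uniq M) (model_sub M) (eq_leq (esym e)).
case: best_pair ref (@best_pairP s (open_pairs s) None) => [[[u v] c]|] ref bestP.
  have [//|[uv_open cE]] := bestP u v c erefl.
  have [vu u_lt cuv _ _] := open_pairsP uv_open.
  rewrite sz in u_lt cE; have v_lt := ltn_trans vu u_lt.
  have uv : pt ps u <> pt ps v by apply: (pt_neq M) => //; lia.
  have [uP vP] : pt ps u \in P /\ pt ps v \in P by split; apply: (pt_mem M).
  have [z zP zuv] : exists2 z, z \in P & blocks z (pt ps u) (pt ps v).
    by apply/blockedP => //; apply/(model_same_col M u_lt v_lt).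
  case: ifP ref => // /allP ref_old ref_new; have [zps|zps] := boolP (z \in ps).
    have m_lt : (index z ps < size ps)%N by rewrite index_mem.
    have zE := nth_index 0 zps; rewrite -zE in zuv.
    have /ref_old : index z ps \in c.
      by rewrite cE mem_filter mem_iota m_lt (candidate_sound M uv_open m_lt zuv).
    have K : knows (record (tab s) u (index z ps) v Lin) ps.
      apply: knows_record; first exact: model_knows M.
      split=> [|_]; first exact: orient_blocks.
      rewrite /= !inE negb_or !andbT; apply/andP; split; [apply/andP; split|]; apply/eqP => //.
        exact/nesym/(blocks_nondeg uv).
      exact/(blocks_nondeg (nesym uv))/blocks_sym.
    have Hbs b : b \in (u, index z ps, v) :: blockings s -> is_blocking ps b.
      by rewrite inE => /predU1P[->|/(model_blockings M)].
    have := refine_sound K Hbs; rewrite sz; case: refine => // t Kt /(IH _ ps cs); apply.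
    by case: M => M1 M2 M3 _ M5 M6 M7 _; split.
  have n_lt := newP z zP zps; rewrite sz n_lt in ref_new.
  have Hrows : describes_new (blocker_rows (tab s) u v) ps z.
    by apply: describes_blocker => //; [exact: model_knows M|exact: model_uniq M|lia].
  have Hbs b : b \in [:: (u, size ps, v)] -> is_blocking (rcons ps z) b.
    by rewrite mem_seq1 => /eqP ->; apply: is_blocking_new.
  have [k [cs' [k_next M' k_new]]] := add_point_sound M zP zps Hrows Hbs.
  have /allP/(_ k k_next) := ref_new; case: eqnP => [ek _|_ ref']; last exact: (IH _ _ _ ref' M').
  by apply: (k_new u u_lt) ek; apply: (blocks_col blockedP zP uP vP uv zuv).
(* No pair is open. Fewer than [size P] points are known, so [P] has a further one, with no
   information on its position. *)
case: ifP ref => // n_lt /allP ref; rewrite sz in n_lt ref.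
have [z zP zps] : exists2 z, z \in P & z \notin ps.
  apply/hasP; rewrite has_predC; apply/negP => /allP sub.
  by have := uniq_leq_size uniqP sub; rewrite leqNgt n_lt.
have [|k [cs' [/ref ref' M' _]]] := add_point_sound (bs := [::]) M zP zps (describes_free ps z).
  by [].
exact: IH ref' M'.
Qed.

End Refutation.

(** * The upper bound *)

Lemma perm_orders (T : eqType) (a b c d : T) :
  [/\ perm_eq [:: a; c; b; d] [:: a; b; c; d], perm_eq [:: c; a; b; d] [:: a; b; c; d],
      perm_eq [:: a; b; d; c] [:: a; b; c; d], perm_eq [:: b; c; a; d] [:: a; b; c; d]
    & perm_eq [:: b; c; d; a] [:: a; b; c; d] /\ perm_eq [:: c; a; d; b] [:: a; b; c; d]].
Proof. by do ?split; apply/permP => q /=; lia. Qed.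

(** * Four points of one colour among thirteen *)

Section Start.
Variables (R : realType) (P : seq 'rV[R]_2) (col : 'rV[R]_2 -> 'I_4).
Hypotheses (blockedP : blocked_by P col) (uniqP : uniq P) (sizeP : size P = 13%N).
Implicit Types a b c d : 'rV[R]_2.

Lemma knows_initial a b c d : knows initial_table [:: a; b; c; d].
Proof.
split; first by split=> // -[|[|[|[|//]]]] _; split=> // -[|[|[|[|//]]]].
by move=> [|[|[|[|//]]]] [|[|[|[|//]]]] [|[|[|[|//]]]] _ _ _; split=> //=; rewrite /orient; ring.
Qed.

Lemma knows_learn_pos st t (ps : seq 'rV[R]_2) : knows t ps ->
  (forall i j k, (i, j, k) \in st -> 0 < orient (pt ps i) (pt ps j) (pt ps k)) ->
  knows (foldl learn_pos t st) ps.
Proof.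
elim: st t => [|[[i j] k] st IH] t K H //=; apply: IH => [|i' j' k' st'].
  by apply: knows_record => //; split=> //=; apply: H; rewrite mem_head.
by apply: H; rewrite inE st' orbT.
Qed.

Lemma start_refuted st a b c d : refuted 13 60 (initial_state st) ->
  uniq [:: a; b; c; d] -> {subset [:: a; b; c; d] <= P} ->
  col a = col b -> col a = col c -> col a = col d ->
  ~ forall i j k, (i, j, k) \in st ->
      0 < orient (pt [:: a; b; c; d] i) (pt [:: a; b; c; d] j) (pt [:: a; b; c; d] k).
Proof.
rewrite -sizeP => ref U sub cb cc cd H.
apply: (refuted_sound blockedP uniqP ref (ps := [:: a; b; c; d]) (cs := [:: col a])).
split=> //=; first by apply: knows_learn_pos => //; apply: knows_initial.
by move=> [|[|[|[|//]]]].
Qed.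

(** On a line, the middle point would differ in colour from the other two. *)
Lemma same_col_orient a b c : a \in P -> b \in P -> c \in P -> uniq [:: a; b; c] ->
  col a = col b -> col a = col c -> orient a b c <> 0.
Proof.
move=> aP bP cP; rewrite /= !inE negb_or andbT => /andP[/andP[/eqP ab /eqP ac] /eqP bc] cb cc o0.
have [abc|[bac|cab]] := collinear_blocks ab ac bc o0.
- exact: (blocks_col blockedP aP bP cP bc abc).
- by apply: (blocks_col blockedP bP aP cP ac bac); rewrite cb.
- by apply: (blocks_col blockedP cP aP bP ab cab); rewrite -cc.
Qed.

(** After making [a], [b], [c] counterclockwise, consider on which side of the three edges [d] lies.
    On the inner side of all: [d] is in the triangle. Beyond exactly one: convex position. Beyond
    two: the vertex common to these two edges is inside the triangle of the other three points.
    Beyond all three is impossible. *)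
Lemma no_four_same_col a b c d : uniq [:: a; b; c; d] -> {subset [:: a; b; c; d] <= P} ->
  col a = col b -> col a = col c -> col a = col d -> False.
Proof.
have convex x y z w : uniq [:: x; y; z; w] -> {subset [:: x; y; z; w] <= P} ->
    col x = col y -> col x = col z -> col x = col w -> 0 < orient x y z -> 0 < orient y z w ->
    0 < orient z w x -> 0 < orient w x y -> False.
  move=> U sub cy cz cw o1 o2 o3 o4; apply: (start_refuted convex_refuted U sub cy cz cw).
  by move=> i j k; rewrite !inE => /or4P[] /eqP[-> -> ->].
have nested x y z w : uniq [:: x; y; z; w] -> {subset [:: x; y; z; w] <= P} ->
    col x = col y -> col x = col z -> col x = col w -> 0 < orient x y z -> 0 < orient x y w ->
    0 < orient y z w -> 0 < orient z x w -> False.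
  move=> U sub cy cz cw o1 o2 o3 o4; apply: (start_refuted nested_refuted U sub cy cz cw).
  by move=> i j k; rewrite !inE => /or4P[] /eqP[-> -> ->].
have perm x y z w x' y' z' w' : uniq [:: x; y; z; w] -> {subset [:: x; y; z; w] <= P} ->
    perm_eq [:: x'; y'; z'; w'] [:: x; y; z; w] ->
    uniq [:: x'; y'; z'; w'] /\ {subset [:: x'; y'; z'; w'] <= P}.
  by move=> U sub e; rewrite (perm_uniq e); split=> // p; rewrite (perm_mem e); apply: sub.
wlog abc : b c / 0 < orient a b c => [IH U sub cb cc cd|].
  have [aP bP cP] : [/\ a \in P, b \in P & c \in P] by split; apply: sub; rewrite !inE eqxx ?orbT.
  have /eqP : orient a b c <> 0.
    apply: same_col_orient => //; move: U; rewrite /= !inE !negb_or.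
    by move=> /and4P[/and3P[-> -> _] /andP[-> _] _ _].
  rewrite neq_lt => /orP[neg|pos]; last exact: (IH b c).
  have [U' sub'] : uniq [:: a; c; b; d] /\ {subset [:: a; c; b; d] <= P}.
    by apply: perm U sub _; have [] := perm_orders a b c d.
  by apply: (IH c b) => //; rewrite orient_swap oppr_gt0.
move=> U sub cb cc cd.
have [aP bP cP dP] : [/\ a \in P, b \in P, c \in P & d \in P].
  by split; apply: sub; rewrite !inE eqxx ?orbT.
have /eqP x0 : orient a b d <> 0.
  apply: same_col_orient => //; move: U; rewrite /= !inE !negb_or.
  by move=> /and4P[/and3P[-> _ ->] /andP[_ ->] _ _].
have /eqP y0 : orient b c d <> 0.
  apply: same_col_orient => //; rewrite -?cb //; move: U; rewrite /= !inE !negb_or.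
  by move=> /and4P[_ /andP[-> ->] -> _].
have /eqP z0 : orient c a d <> 0.
  apply: same_col_orient => //; rewrite -?cc //; move: U; rewrite /= !inE !negb_or.
  by rewrite (eq_sym c a) => /and4P[/and3P[_ -> ->] _ -> _].
have convex' x y z w : perm_eq [:: x; y; z; w] [:: a; b; c; d] -> 0 < orient x y z ->
    0 < orient y z w -> 0 < orient z w x -> 0 < orient w x y -> False.
  move=> e; have [U' sub'] := perm _ _ _ _ _ _ _ _ U sub e.
  have same p : p \in [:: a; b; c; d] -> col p = col a by rewrite !inE => /or4P[]/eqP->.
  by apply: convex => //; rewrite !same // -(perm_mem e) !inE eqxx ?orbT.
have nested' x y z w : perm_eq [:: x; y; z; w] [:: a; b; c; d] -> 0 < orient x y z ->
    0 < orient x y w -> 0 < orient y z w -> 0 < orient z x w -> False.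
  move=> e; have [U' sub'] := perm _ _ _ _ _ _ _ _ U sub e.
  have same p : p \in [:: a; b; c; d] -> col p = col a by rewrite !inE => /or4P[]/eqP->.
  by apply: nested => //; rewrite !same // -(perm_mem e) !inE eqxx ?orbT.
have [_ cabd abdc bcad [bcda cadb]] := perm_orders a b c d.
have flip (o : R) : o != 0 -> ~~ (0 < o) -> o < 0 by rewrite -leNgt lt_neqAle => -> ->.
have [x|/(flip _ x0) x] := boolP (0 < orient a b d);
  have [y|/(flip _ y0) y] := boolP (0 < orient b c d);
  have [z|/(flip _ z0) z] := boolP (0 < orient c a d).
- exact: (nested' a b c d (perm_refl _)).
- apply: (convex' a b c d (perm_refl _) abc y); first by rewrite orient_swap oppr_gt0.
  by rewrite orient_rotr.
- apply: (convex' c a b d cabd _ x); first by rewrite orient_rotr.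
    by rewrite orient_swap oppr_gt0.
  by rewrite orient_rotr.
- apply: (nested' a b d c abdc x abc); first by rewrite orient_swap oppr_gt0.
  by rewrite orient_swap oppr_gt0 orient_rotr.
- apply: (convex' b c a d bcad _ z); first by rewrite orient_rot.
    by rewrite orient_swap oppr_gt0.
  by rewrite orient_rotr.
- apply: (nested' b c d a bcda y); first by rewrite orient_rot.
    by rewrite orient_swap oppr_gt0.
  by rewrite orient_swap oppr_gt0 orient_rotr.
- apply: (nested' c a d b cadb z); first by rewrite orient_rotr.
    by rewrite orient_swap oppr_gt0.
  by rewrite orient_swap oppr_gt0 orient_rotr.
(* Three negative areas cannot add up to the positive area of [a], [b], [c]. *)
- by have := orient4 a b c d; rewrite (orient_rotr b c d) (orient_rot c a d); clear -abc x y z; lra.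
Qed.

End Start.

(** * Reduction to thirteen points *)

Section Upper.
Variable R : realType.
Implicit Types (s : seq 'rV[R]_2) (P : {fset 'rV[R]_2}).

(** Take the lowest of the leftmost points. If it were between two points, both would be leftmost as
    well and neither would be lower, so they would coincide. *)
Lemma extreme_point s : s <> [::] ->
  exists2 z, z \in s & forall v w, v \in s -> w \in s -> v <> w -> ~ blocks z v w.
Proof.
case: s => // a s _; set r := a :: s.
have [y [yr _ miny]] : exists y, [/\ y \in r, True & forall x, x \in r -> True -> y 0 0 <= x 0 0].
  by apply: (argmin_seq (Q := fun=> True)); exists a; rewrite ?mem_head.
have [z [zr zy minz]] : exists z, [/\ z \in r, z 0 0 = y 0 0 &
    forall x, x \in r -> x 0 0 = y 0 0 -> z 0 1 <= x 0 1].
  by apply: (argmin_seq (Q := fun x : 'rV[R]_2 => x 0 0 = y 0 0)); exists y.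
exists z => // v w vr wr vw [t [/andP[t0 t1] /rowP zE]]; apply: vw.
have := zE 0; have := zE 1; rewrite !mxE zy => e1 e0.
have v0 := miny v vr I; have w0 := miny w wr I.
have ev : v 0 0 = y 0 0 by nra.
have ew : w 0 0 = y 0 0 by nra.
have v1 := minz v vr ev; have w1 := minz w wr ew.
by apply: plane_eq; [rewrite ev ew|nra].
Qed.

(** An extreme point blocks no pair, so deleting it leaves all other pairs with their blockers; the
    induction is on the number of points to delete. *)
Lemma blocked_by_size (col : 'rV[R]_2 -> 'I_4) n s : uniq s -> blocked_by s col ->
  (n <= size s)%N -> exists s', [/\ uniq s', blocked_by s' col & size s' = n].
Proof.
move: {2}(size s - n)%N (erefl (size s - n)%N) => k; elim: k s => [|k IH] s ks U B n_le.
  by exists s; split=> //; lia.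
have [|z zs zext] := @extreme_point s; first by move=> s0; move: ks; rewrite s0.
apply: (IH (rem z s)); rewrite ?rem_uniq ?size_rem //.
- by rewrite -predn_sub ks.
- move=> v w; rewrite !mem_rem_uniq // !inE => /andP[_ vs] /andP[_ ws] vw.
  rewrite B //; split=> [[x xs xvw]|[x]]; last first.
    by rewrite mem_rem_uniq // inE => /andP[_ xs] xvw; exists x.
  exists x => //; rewrite mem_rem_uniq // inE xs andbT.
  by apply/eqP => xz; apply: (zext v w) => //; rewrite -xz.
- have n_lt : (n < size s)%N by rewrite -subn_gt0 ks.
  by rewrite -ltnS (ltn_predK n_lt).
Qed.

Lemma pigeonhole13 (T : Type) (col : T -> 'I_4) (s : seq T) : size s = 13%N ->
  exists k, (3 < count (fun x => col x == k) s)%N.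
Proof.
move=> s13; apply/existsP; apply: contraT; rewrite negb_exists => /forallP small.
have : (size s <= 12)%N; last by rewrite s13.
rewrite -sum1_size (partition_big col predT) //=.
have -> : 12%N = (\sum_(k < 4) 3)%N by rewrite sum_nat_const card_ord.
by apply: leq_sum => k _; rewrite sum1_count leqNgt; apply: small.
Qed.

Lemma blocked_by_fset P : blocked 4 P -> exists col, blocked_by P col.
Proof.
case=> c cP; exists (fun x => oapp c 0 (insub x)) => v w vP wP vw.
rewrite !insubT /=; set v' := Sub v vP; set w' := Sub w wP.
have vw' : v' <> w' by move/(congr1 val); rewrite !SubK.
have := cP v' w' vw'; rewrite /visible !SubK => visP.
split=> [cvw|[x xP xvw]].
  (* As [visible] is a negated existence, a blocker is obtained by classical reasoning. *)
  by apply: contrapT => no; apply: visP.1 cvw => -[x [xP xvw]]; apply: no; exists x.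
by apply: contrapT => /visP; apply; exists x.
Qed.

Lemma blocked_card P : blocked 4 P -> (#|` P| <= 12)%N.
Proof.
move=> /blocked_by_fset[col B]; rewrite leqNgt; apply/negP => big.
have [s [U Bs s13]] := blocked_by_size (fset_uniq P) B big.
have [k] := pigeonhole13 col s13; rewrite -size_filter.
have fs : {subset filter (fun x => col x == k) s <= s} by move=> x; rewrite mem_filter => /andP[].
have fc x : x \in filter (fun x => col x == k) s -> col x = k by rewrite mem_filter => /andP[/eqP].
have := filter_uniq (fun x => col x == k) U.
case: (filter _ s) fs fc => [|a [|b [|c [|d r]]]] // fs fc Uf _.
rewrite -[a :: _]/([:: a; b; c; d] ++ r) in fs fc Uf.
have sub4 : {subset [:: a; b; c; d] <= [:: a; b; c; d] ++ r}.
  by move=> x; rewrite mem_cat => ->.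
have U4 : uniq [:: a; b; c; d] by move: Uf; rewrite cat_uniq => /andP[].
have col4 x : x \in [:: a; b; c; d] -> col x = k by move/sub4/fc.
apply: (no_four_same_col Bs U s13 U4); first by move=> x /sub4/fs.
- by rewrite !col4 // !inE eqxx ?orbT.
- by rewrite !col4 // !inE eqxx ?orbT.
- by rewrite !col4 // !inE eqxx ?orbT.
Qed.

End Upper.

(** * A set of twelve points *)

(** Betweenness without division, so that it can be computed: the cross product of [x - v] and
    [w - v] vanishes, and their scalar product is strictly between 0 and the squared length of
    [w - v]. *)
Definition between_int (x v w : int * int) : bool :=
  let x0 := x.1 - v.1 in let x1 := x.2 - v.2 in
  let w0 := w.1 - v.1 in let w1 := w.2 - v.2 in
  [&& x0 * w1 == x1 * w0, 0 < x0 * w0 + x1 * w1 & x0 * w0 + x1 * w1 < w0 * w0 + w1 * w1].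

(* Found by a computer search. *)
Definition twelve_points : seq (int * int) :=
  zip [:: 16; 0; 5; 13; 25; 10; 103; 25; 25; 70; 37; 55]
      [:: 57; 67; 64; 60; 52; 63; 0; 54; 57; 27; 54; 54].

Definition twelve_colours : seq nat := [:: 1; 0; 3; 2; 0; 1; 2; 3; 0; 1; 2; 3]%N.

Definition twelve_colour (p : int * int) : nat := nth 0%N twelve_colours (index p twelve_points).

Lemma twelve_points_blocked : all (fun p => all (fun q => (p == q) ||
  (has (fun x => between_int x p q) twelve_points == (twelve_colour p == twelve_colour q)))
  twelve_points) twelve_points.
Proof. by vm_compute. Qed.

Section Example12.
Variable R : realType.

Definition embed (p : int * int) : 'rV[R]_2 := \row_j (if j == 0 then p.1 else p.2)%:~R.

Lemma embed0 p : embed p 0 0 = p.1%:~R. Proof. by rewrite mxE. Qed.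
Lemma embed1 p : embed p 0 1 = p.2%:~R. Proof. by rewrite mxE. Qed.

Lemma embed_inj : injective embed.
Proof.
move=> [a b] [a' b'] /rowP e; have := e 0; have := e 1; rewrite !mxE /=.
by move=> /eqP; rewrite eqr_int => /eqP -> /eqP; rewrite eqr_int => /eqP ->.
Qed.

Lemma blocks_embed x v w : v <> w -> blocks (embed x) (embed v) (embed w) <-> between_int x v w.
Proof.
move=> vw; rewrite /between_int.
rewrite -(eqr_int R) -2!(ltr_int R) !(rmorphD, rmorphM, rmorphN, rmorph0) /=.
rewrite -!embed0 -!embed1.
have evw : embed v <> embed w by move/embed_inj.
move: (embed x) (embed v) (embed w) evw => {vw} a b c bc.
set x0 := a 0 0 - b 0 0; set x1 := a 0 1 - b 0 1; set w0 := c 0 0 - b 0 0; set w1 := c 0 1 - b 0 1.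
have q0 : 0 < w0 * w0 + w1 * w1.
  rewrite -!expr2 lt_def addr_ge0 ?sqr_ge0 // andbT paddr_eq0 ?sqr_ge0 // !sqrf_eq0.
  rewrite !subr_eq0; apply/negP => /andP[/eqP e0 /eqP e1].
  by apply: bc; apply: plane_eq.
split=> [[t [/andP[t0 t1] xE]]|/and3P[/eqP o0 d0 d1]].
  have e0 : x0 = t * w0 by rewrite /x0 xE !mxE /w0; ring.
  have e1 : x1 = t * w1 by rewrite /x1 xE !mxE /w1; ring.
  have -> : x0 * w0 + x1 * w1 = t * (w0 * w0 + w1 * w1) by rewrite e0 e1; ring.
  by rewrite pmulr_rgt0 // q0 -[X in _ && (_ < X)]mul1r ltr_pM2r // t1 e0 e1 mulrAC eqxx.
have q_neq0 := lt0r_neq0 q0.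
(* The parameter of the orthogonal projection onto the line, which is the point itself by
   collinearity. *)
exists ((x0 * w0 + x1 * w1) / (w0 * w0 + w1 * w1)); split.
  by rewrite divr_gt0 //= ltr_pdivrMr // mul1r.
have e0 : x0 = (x0 * w0 + x1 * w1) / (w0 * w0 + w1 * w1) * w0.
  apply: (mulfI q_neq0); rewrite mulrA mulrCA mulfV // mulr1.
  have -> : (w0 * w0 + w1 * w1) * x0 = x0 * w0 * w0 + (x0 * w1) * w1 by ring.
  by rewrite o0; ring.
have e1 : x1 = (x0 * w0 + x1 * w1) / (w0 * w0 + w1 * w1) * w1.
  apply: (mulfI q_neq0); rewrite mulrA mulrCA mulfV // mulr1.
  have -> : (w0 * w0 + w1 * w1) * x1 = (x1 * w0) * w0 + x1 * w1 * w1 by ring.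
  by rewrite -o0; ring.
set t := _ / _ in e0 e1 *.
apply: plane_eq; rewrite !mxE.
  have -> : a 0 0 = x0 + b 0 0 by rewrite /x0; ring.
  by rewrite e0 /w0; ring.
have -> : a 0 1 = x1 + b 0 1 by rewrite /x1; ring.
by rewrite e1 /w1; ring.
Qed.

Lemma twelve_blocked : exists P : {fset 'rV[R]_2}, blocked 4 P /\ #|` P| = 12%N.
Proof.
exists (seq_fset tt (map embed twelve_points)); split; last first.
  by rewrite size_seq_fset undup_id ?size_map // (map_inj_uniq embed_inj).
exists (fun v => inord (nth 0%N twelve_colours (index (val v) (map embed twelve_points)))).
move=> v w; have := valP v; have := valP w; rewrite !seq_fsetE.
move=> /mapP[q qin eq] /mapP[p pin ep] vw.
have pq : p <> q by move=> pq; apply: vw; apply: val_inj; rewrite ep eq pq.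
rewrite {}ep {}eq !(index_map embed_inj) -!/(twelve_colour _).
(* Numbers below 4 are not identified by [inord], so comparing colours in ['I_4] amounts to
   comparing these numbers. *)
have lt4 r : (twelve_colour r < 4)%N.
  rewrite /twelve_colour; case: (ltnP (index r twelve_points) 12) => [|i_ge].
    by move: (index _ _); do 12! case=> //.
  by rewrite nth_default.
have /orP[/eqP/pq//|/eqP hasE] := allP (allP twelve_points_blocked p pin) q qin.
have -> : (inord (twelve_colour p) : 'I_4) <> inord (twelve_colour q) <->
    twelve_colour p <> twelve_colour q.
  by split=> ne e; apply: ne; [rewrite e|rewrite -(inordK (lt4 p)) e inordK].
have blockE : (exists x, x \in seq_fset tt (map embed twelve_points) /\
      blocks x (embed p) (embed q))
    <-> has (fun x => between_int x p q) twelve_points.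
  split=> [[x []]|/hasP[x xin xpq]].
    rewrite seq_fsetE => /mapP[y yin ->] /(blocks_embed y pq) ypq; apply/hasP; by exists y.
  by exists (embed x); rewrite seq_fsetE map_f //; split=> //; apply/blocks_embed.
rewrite /visible; split=> [no_block ec|ne /blockE].
  by apply: no_block; apply/blockE; rewrite hasE ec eqxx.
by rewrite hasE => /eqP.
Qed.

End Example12.

Local Open Scope nat_scope.
Local Open Scope fset_scope.

Theorem corollary24 (R : realType) :
  (forall P : {fset 'rV[R]_2}, blocked 4 P -> #|` P| <= 12) /\
  (exists P : {fset 'rV[R]_2}, blocked 4 P /\ #|` P| = 12).
Proof.
by split; [move=> P; apply: blocked_card | apply: twelve_blocked].
Qed.
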